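(* Let $E$ be a field of characteristic different from $2$. Let $f\in E[X]\setminus E$ be separable and set $\vartheta=X+(f)\in E_f=E[X]/(f)$. Assume that the affine curve $Y^2=f(X)$ over $E$ has a point of odd degree and that, for every $\alpha\in E_f^\times$, there exists $a\in E$ such that $\vartheta-a\in\alpha E_f^{\times 2}$. Then $f$ is square-reflexive.
   Context: A polynomial is separable if it has no multiple roots in an algebraic closure of $E$. The affine curve $Y^2=f(X)$ has a point of odd degree over $E$ if there exist elements $x,y$ in an algebraic field extension of $E$ with $y^2=f(x)$ and $[E[x,y]:E]$ odd. For a commutative ring $R$ let $R^\times$ be its group of units and $R^{\times 2}=\{x^2\mid x\in R^\times\}$; an element of $R$ is square-free if it is not equal to $x^2y$ for any $x\in R\setminus R^\times$ and $y\in R$. For a nonzero $f\in E[X]$ put $E_f=E[X]/(f)$, let $\mathrm{N}_{E_f/E}:E_f\to E$ be the norm of this finite-dimensional $E$-algebra and let $\mathrm{lc}(f)$ be the leading coefficient of $f$. A square-free polynomial $f\in E[X]\setminus\{0\}$ is called square-reflexive if for every $\alpha\in E_f^\times$ with $\mathrm{N}_{E_f/E}(\alpha)\in E^{\times 2}\cup \mathrm{lc}(f)E^{\times 2}$ there exists a polynomial $g\in E[X]$ coprime to $f$ such that $g+(f)\in\alpha E_f^{\times 2}$ and $f+(g)\in E_g^{\times 2}$. *)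

(* Defs.v *)
From HB Require Import structures.
From mathcomp Require Import all_boot all_order all_algebra all_field.
From mathcomp Require Import qpoly.

Set Implicit Arguments.
Unset Strict Implicit.
Unset Printing Implicit Defensive.

Import GRing.Theory.
Local Open Scope ring_scope.

(* R may be the zero ring (as E[X]/(f) is for a nonzero constant f), so the
   unitRingType predicate GRing.unit, which needs 1 != 0, cannot be used. *)
Definition is_unit (R : comPzRingType) (x : R) : Prop := exists y : R, x * y = 1.

(* x \in a R^{x2} *)
Definition in_square_class (R : comPzRingType) (a x : R) : Prop :=
  exists2 u : R, is_unit u & x = a * u ^+ 2.

(* x \in R^{x2} *)
Definition is_unit_square (R : comPzRingType) (x : R) : Prop :=
  exists2 u : R, is_unit u & x = u ^+ 2.

Definition square_free (R : comPzRingType) (r : R) : Prop :=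
  forall x y : R, ~ is_unit x -> r <> x ^+ 2 * y.

(* The E-algebra E[X]/(f) for nonzero f, represented by the remainders modulo f.
   The library's {poly %/ f} is E[X]/(f) only if f is monic and nonconstant.
   For f = 0 the type below is trivial, hence not E[X]; it is used only for
   nonzero f, where polymodK, polymod_eq0 and the ring morphism structure of
   polymod identify it with E[X]/(f). *)
Definition polyquot (E : fieldType) (f : {poly E}) : Type :=
  {poly_(size f).-1 E}.

HB.instance Definition _ (E : fieldType) (f : {poly E}) :=
  Vector.copy (polyquot f) {poly_(size f).-1 E}.

(* The class p + (f). *)
Definition polymod (E : fieldType) (f p : {poly E}) : polyquot f :=
  npolyp (size f).-1 (p %% f).

Section PolyQuot.
Variables (E : fieldType) (f : {poly E}).

Definition polyquot_val (a : polyquot f) : {poly E} := polyn a.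
Local Notation pval := polyquot_val.

Lemma polyquot_val_inj : injective pval.
Proof. exact: val_inj. Qed.

Lemma polyquot0_eq (a b : polyquot f) : f = 0 -> a = b.
Proof.
move=> f0; apply: polyquot_val_inj.
have size0 (c : polyquot f) : pval c = 0.
  apply/eqP; rewrite -size_poly_leq0 /pval.
  by have := size_npoly c; rewrite {2}f0 size_poly0.
by rewrite !size0.
Qed.

Lemma polymodE (p : {poly E}) : f != 0 -> pval (polymod f p) = p %% f.
Proof.
move=> f0; rewrite /pval /polymod npolypK //.
by rewrite -ltnS prednK ?size_poly_gt0 // ltn_modp.
Qed.

Lemma polyquot_val_mod (a : polyquot f) : f != 0 -> pval a %% f = pval a.
Proof.
move=> f0; rewrite modp_small // -[size f]prednK ?size_poly_gt0 // ltnS.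
exact: size_npoly.
Qed.

Lemma polymodK (a : polyquot f) : polymod f (pval a) = a.
Proof.
have [f0|f0] := eqVneq f 0; first exact: polyquot0_eq.
by apply: polyquot_val_inj; rewrite polymodE // polyquot_val_mod.
Qed.

Lemma polymod_eq0 (p : {poly E}) : f != 0 -> (polymod f p == 0) = (f %| p).
Proof.
move=> f0; apply/eqP/idP => [/(congr1 pval)|/eqP fp].
  by rewrite polymodE // => /eqP.
by apply: polyquot_val_inj; rewrite polymodE.
Qed.

Definition polyquot_one : polyquot f := polymod f 1.
Definition polyquot_mul (a b : polyquot f) : polyquot f :=
  polymod f (pval a * pval b).

Fact polyquot_mulC : commutative polyquot_mul.
Proof. by move=> a b; rewrite /polyquot_mul mulrC. Qed.

Fact polyquot_mulA : associative polyquot_mul.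
Proof.
move=> a b c; have [f0|f0] := eqVneq f 0; first exact: polyquot0_eq.
apply: polyquot_val_inj; rewrite !polymodE //.
by rewrite modp_mul [X in _ = X %% f]mulrC modp_mul mulrA mulrC.
Qed.

Fact polyquot_mul1 : left_id polyquot_one polyquot_mul.
Proof.
move=> a; have [f0|f0] := eqVneq f 0; first exact: polyquot0_eq.
apply: polyquot_val_inj; rewrite !polymodE // mulrC modp_mul mulr1.
exact: polyquot_val_mod.
Qed.

Fact polyquot_mulDl : left_distributive polyquot_mul +%R.
Proof.
move=> a b c; have [f0|f0] := eqVneq f 0; first exact: polyquot0_eq.
apply: polyquot_val_inj.
have pvalD (u v : polyquot f) : pval (u + v) = pval u + pval v by [].
by rewrite pvalD !polymodE // pvalD mulrDl modpD.
Qed.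

HB.instance Definition _ := GRing.Zmodule_isComPzRing.Build (polyquot f)
  polyquot_mulA polyquot_mulC polyquot_mul1 polyquot_mulDl.

Fact polymod_is_linear : linear (polymod f).
Proof.
move=> c p q; have [f0|f0] := eqVneq f 0; first exact: polyquot0_eq.
apply: polyquot_val_inj.
have pvalP (u v : polyquot f) : pval (c *: u + v) = c *: pval u + pval v by [].
by rewrite pvalP !polymodE // modpD modpZl.
Qed.

HB.instance Definition _ :=
  GRing.isLinear.Build E {poly E} (polyquot f) *:%R (polymod f)
    polymod_is_linear.

Fact polymod_is_monoid_morphism : monoid_morphism (polymod f).
Proof.
split=> // p q; have [f0|f0] := eqVneq f 0; first exact: polyquot0_eq.
apply: polyquot_val_inj.
rewrite -[RHS]/(pval (polymod f (pval (polymod f p) * pval (polymod f q)))).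
by rewrite !polymodE // modp_mul mulrC -[LHS]modp_mul mulrC.
Qed.

HB.instance Definition _ :=
  GRing.isMonoidMorphism.Build {poly E} (polyquot f) (polymod f)
    polymod_is_monoid_morphism.

(* Row i is the coordinate vector of a * X^i in the basis 1, X, ..., X^(n-1),
   n = deg f; for a nonzero constant f the determinant is empty, hence 1. *)
Definition polyquot_norm (a : polyquot f) : E :=
  \det (\matrix_(i < (size f).-1, j < (size f).-1)
          (pval (a * polymod f 'X^i))`_j).

End PolyQuot.

(* x and y generate a finite subextension, so taking the extension L finite
   (as fieldExtType does) is no restriction compared to L algebraic. *)
Definition has_odd_degree_point (E : fieldType) (f : {poly E}) : Prop :=
  exists (L : fieldExtType E) (x y : L),
    y ^+ 2 = (map_poly (in_alg L) f).[x] /\ odd (\dim <<1 & [:: x; y]>>%VS).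

Definition square_reflexive (E : fieldType) (f : {poly E}) : Prop :=
  [/\ f != 0, square_free f &
    forall alpha : polyquot f, is_unit alpha ->
      is_unit_square (polyquot_norm alpha) \/
        in_square_class (lead_coef f) (polyquot_norm alpha) ->
      exists g : {poly E},
        [/\ g != 0, coprimep g f,
            in_square_class alpha (polymod f g) &
            is_unit_square (polymod g f)]].

(* Main.v *)
Require Import Defs.
From HB Require Import structures.
From mathcomp Require Import all_boot all_order all_algebra all_field.
From mathcomp Require Import qpoly.
From mathcomp Require Import ring.
From Stdlib Require Import Classical.

Set Implicit Arguments.
Unset Strict Implicit.
Unset Printing Implicit Defensive.

Import GRing.Theory.
Local Open Scope ring_scope.

(** Write [n] for the degree of [f], [lc] for its leading coefficient, [N] for
    the norm of [E[X]/(f)], and [~] for equality of classes modulo squares of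
    units.

    The class hypothesis replaces any [p] coprime to [f] by some linear
    [X - a ~ p].  Since [f(a) = (-1)^n * lc * N(X - a)]
    ([horner_norm_XsubC]), the value [f(a)] is then known modulo squares from
    [N(p)] alone ([linear_in_class]).

    The point of odd degree is used through reciprocity.  It provides a monic
    [g] of odd degree, coprime to [f], modulo which [f] is a square
    ([odd_degree_coprime]).  The norm of [f] in [E[X]/(g)] is then a square;
    like [N(g)], it is the resultant of [f] and [g] up to sign and a power of
    [lc].  Keeping track of both, and because the degree of [g] is odd,
    [(-1)^n * lc * N(g)] is a square ([norm_odd_square]).  Applying the class
    hypothesis to this [g] yields [b] in [E] such that [f(b)] is a nonzero
    square ([rational_square_point]): the curve has a rational point that is
    not a Weierstrass point.

    Now let [N(p)] be a square.  Choose [a] with [X - a ~ p * (X - b)].  Then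
    [f(a)] is [N(p) * f(b)] modulo squares, so it is a square, and
    if [a] and [b] differ, [g = (X - a) * (X - b) ~ p] works: modulo [g], the polynomial [f] is the
    square of the linear polynomial interpolating square roots of [f(a)] and
    [f(b)], while for [a = b] one has [p ~ 1] and [g = 1] works
    ([norm_square_reflexive]).  If instead [N(p)] is [lc] modulo
    squares, then for even [n] the linear polynomial [X - a ~ p] itself works,
    as [f(a)] is [lc * N(p)] modulo squares; for odd [n] the norm of [lc * p]
    is [lc^n * N(p)], a square, and multiplying the polynomial found for
    [lc * p] by the constant [1 / lc] solves the problem for [p]. *)

(** * Splitting extensions *)

Lemma irreducible_divisor (E : fieldType) (p : {poly E}) :
  (1 < size p)%N -> exists2 q, q %| p & irreducible_poly q.
Proof.
have [n] := ubnP (size p); elim: n p => // n IHn p lt_p_n p_gt1.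
have [irr_p|red_p] := classic (irreducible_poly p); first by exists p.
have [|q] := not_all_ex_not _ (fun q : {poly E} =>
    size q != 1%N -> q %| p -> q %= p).
  by move=> irr_p; apply: red_p; split.
move=> red_q; have [q_neq1 {}red_q] := imply_to_and _ _ red_q.
have [q_p neq_qp] := imply_to_and _ _ red_q.
have p_neq0 : p != 0 by rewrite -size_poly_gt0 ltnW.
have q_neq0 : q != 0 by apply: contraTneq q_p => ->; rewrite dvd0p.
have q_gt1 : (1 < size q)%N by rewrite ltn_neqAle eq_sym q_neq1 size_poly_gt0.
have lt_q_p : (size q < size p)%N.
  by rewrite ltn_neqAle dvdp_size_eqp // dvdp_leq // andbT; apply/negP.
have [r r_q irr_r] := IHn q (leq_trans lt_q_p lt_p_n) q_gt1.
by exists r => //; apply: dvdp_trans r_q q_p.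
Qed.

(** The target is only a field with a ring morphism from [E], which lets the
    induction adjoin one root at a time without comparing the algebra
    structures of a tower. *)
Lemma splitting_extension (E : fieldType) (p : {poly E}) :
  exists (K : fieldType) (iota : {rmorphism E -> K}) (rs : seq K),
    map_poly iota p = iota (lead_coef p) *: \prod_(r <- rs) ('X - r%:P).
Proof.
have [n] := ubnP (size p); elim: n E p => // n IHn E p lt_p_n.
have [p_le1|p_gt1] := leqP (size p) 1%N.
  exists E, idfun, [::]; rewrite big_nil map_poly_id // /=.
  by rewrite [p in LHS]size1_polyC // [p in RHS]size1_polyC // lead_coefC
             alg_polyC.
have [q q_p irr_q] := irreducible_divisor p_gt1.
have [L _ [z qz _]] := irredp_FAdjoin irr_q.
have /factor_theorem[s Ds] : root (map_poly (in_alg L) p) z.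
  by rewrite -(divpK q_p) rmorphM rootM qz orbT.
have p_neq0 : p != 0 by rewrite -size_poly_gt0 ltnW.
have s_neq0 : s != 0.
  apply: contraNneq p_neq0 => s0; rewrite -(map_poly_eq0 (in_alg L)).
  by rewrite Ds s0 mul0r.
have lt_s_n : (size s < n)%N.
  rewrite ltnS -(size_map_poly (in_alg L)) Ds in lt_p_n.
  by rewrite size_Mmonic ?monicXsubC // size_XsubC addn2 in lt_p_n.
have [K [iota [rs Drs]]] := IHn L s lt_s_n.
exists K, (iota \o in_alg L)%FUN, (iota z :: rs).
have Dlc : (lead_coef p)%:A = lead_coef s :> L.
  by rewrite -[_%:A]/(in_alg L _) -lead_coef_map Ds lead_coefM
             lead_coefXsubC mulr1.
rewrite map_poly_comp [in LHS]Ds rmorphM /= Dlc Drs map_polyXsubC.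
by rewrite big_cons mulrC scalerAr.
Qed.

(** * Norms and resultants *)

(** The coordinates of [g * X^i] modulo [f], used as coefficients at a root
    [r] of [f], add up to [g(r) * r^i].  So the Vandermonde matrix of the roots,
    invertible as they are distinct, conjugates multiplication by [g] to the
    diagonal matrix of the values of [g]. *)
Lemma norm_prod_roots (E K : fieldType) (iota : {rmorphism E -> K})
    (f g : {poly E}) (rs : seq K) :
  f != 0 -> uniq rs ->
  map_poly iota f = iota (lead_coef f) *: \prod_(r <- rs) ('X - r%:P) ->
  iota (polyquot_norm (polymod f g)) =
    \prod_(r <- rs) (map_poly iota g).[r].
Proof.
move=> f_neq0 uniq_rs Df.
have sz_rs : (size f).-1 = size rs.
  rewrite -(size_map_poly iota) Df size_scale ?size_prod_XsubC //.
  by rewrite fmorph_eq0 lead_coef_eq0.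
have eval_modp (p : {poly E}) (j : 'I_(size f).-1) :
    (map_poly iota (p %% f)).[rs`_j] = (map_poly iota p).[rs`_j].
  rewrite [p in RHS](divp_eq p f) rmorphD rmorphM /= hornerD hornerM.
  suff /rootP-> : root (map_poly iota f) rs`_j by rewrite mulr0 add0r.
  rewrite Df rootZ ?fmorph_eq0 ?lead_coef_eq0 // root_prod_XsubC mem_nth //.
  by rewrite -sz_rs.
rewrite /polyquot_norm -det_map_mx; set M := map_mx _ _.
pose V := Vandermonde (size f).-1 (\row_(j < (size f).-1) rs`_j).
pose D := diag_mx (\row_(j < (size f).-1) (map_poly iota g).[rs`_j]).
have MV : M *m V = V *m D.
  apply/matrixP=> i j; rewrite mul_mx_diag !mxE.
  transitivity (map_poly iota ((g * 'X^i) %% f)).[rs`_j].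
    rewrite (horner_coef_wide _ (n := (size f).-1)); last first.
      by rewrite size_map_poly -ltnS prednK ?size_poly_gt0 // ltn_modp.
    apply: eq_bigr => k _; rewrite !mxE -rmorphM /= polymodE //.
    by rewrite coef_map.
  by rewrite eval_modp rmorphM hornerM /= map_polyXn hornerXn mulrC.
have detV : \det V != 0.
  rewrite det_Vandermonde; apply/prodf_neq0 => i _; apply/prodf_neq0 => j ltij.
  rewrite !mxE subr_eq0 nth_uniq -?sz_rs //.
  by rewrite neq_ltn ltij orbT.
apply: (mulIf detV); rewrite -det_mulmx MV det_mulmx mulrC det_diag.
congr (_ * _); rewrite (big_nth 0) -sz_rs big_mkord.
by apply: eq_bigr => j _; rewrite mxE.
Qed.

Lemma prodMl_seq (R : comPzRingType) (I : Type) (rs : seq I) (c : R)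
    (F : I -> R) :
  \prod_(r <- rs) (c * F r) = c ^+ size rs * \prod_(r <- rs) F r.
Proof. by rewrite big_split big_const_seq count_predT iter_mulr_1. Qed.

Lemma horner_char_poly (R : comNzRingType) (n : nat) (A : 'M[R]_n) (x : R) :
  (char_poly A).[x] = \det (x%:M - A).
Proof.
rewrite -horner_evalE -det_map_mx; congr (\det _).
apply/matrixP=> i j; rewrite !mxE /= /horner_eval hornerD hornerN hornerC.
by rewrite hornerMn hornerX.
Qed.

(** For the companion matrix [A] of [g] this computes the norm of [f] in
    [E[X]/(g)] from the values of [g] at the roots of [f].  It is proved by
    factoring [f] rather than by diagonalizing [A], so that it also covers an
    inseparable [g], such as the minimal polynomial of an inseparable point. *)
Lemma det_horner_mx (E K : fieldType) (iota : {rmorphism E -> K}) (n : nat)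
    (A : 'M[E]_n.+1) (f : {poly E}) (rs : seq K) :
  map_poly iota f = iota (lead_coef f) *: \prod_(r <- rs) ('X - r%:P) ->
  iota (\det (horner_mx A f)) = iota (lead_coef f) ^+ n.+1 *
    \prod_(r <- rs) ((-1) ^+ n.+1 * (map_poly iota (char_poly A)).[r]).
Proof.
move=> Df; rewrite -det_map_mx map_horner_mx Df linearZ /= detZ.
congr (_ * _); elim: rs {Df} => [|r rs IHrs].
  by rewrite !big_nil rmorph1 det1.
rewrite !big_cons rmorphM /= det_mulmx IHrs; congr (_ * _).
rewrite rmorphB /= horner_mx_X horner_mx_C map_char_poly horner_char_poly.
by rewrite -detZ scaleN1r opprB.
Qed.

Section NormOfSeparable.

Variables (E : fieldType) (f : {poly E}).
Hypothesis f_sep : separable_poly f.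

Local Notation n := (size f).-1.
Local Notation N g := (polyquot_norm (polymod f g)).

Lemma separable_splitting : exists (K : fieldType) (iota : {rmorphism E -> K})
    (rs : seq K),
  [/\ size rs = n,
    map_poly iota f = iota (lead_coef f) *: \prod_(r <- rs) ('X - r%:P) &
    forall g, iota (N g) = \prod_(r <- rs) (map_poly iota g).[r]].
Proof.
have f_neq0 := separable_poly_neq0 f_sep.
have [K [iota [rs Df]]] := splitting_extension f.
have lc_neq0 : iota (lead_coef f) != 0 by rewrite fmorph_eq0 lead_coef_eq0.
have uniq_rs : uniq rs.
  rewrite -separable_prod_XsubC -(eqp_separable (eqp_scale _ lc_neq0)) -Df.
  by rewrite separable_map.
exists K, iota, rs; split=> //.
  by rewrite -(size_map_poly iota) Df size_scale // size_prod_XsubC.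
by move=> g; apply: norm_prod_roots.
Qed.

Lemma normM g h : N (g * h) = N g * N h.
Proof.
have [K [iota [rs [_ _ DN]]]] := separable_splitting.
apply: (fmorph_inj iota); rewrite rmorphM /= !DN -big_split /=.
by apply: eq_bigr => r _; rewrite rmorphM hornerM.
Qed.

Lemma normZ c g : N (c *: g) = c ^+ n * N g.
Proof.
have [K [iota [rs [sz_rs _ DN]]]] := separable_splitting.
apply: (fmorph_inj iota); rewrite rmorphM rmorphXn /= !DN -sz_rs.
by rewrite -prodMl_seq; apply: eq_bigr => r _; rewrite map_polyZ hornerZ.
Qed.

Lemma horner_norm_XsubC a : f.[a] = (-1) ^+ n * lead_coef f * N ('X - a%:P).
Proof.
have [K [iota [rs [sz_rs Df DN]]]] := separable_splitting.
apply: (fmorph_inj iota); rewrite !rmorphM rmorphXn rmorphN1 /= DN -sz_rs.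
rewrite -horner_map Df hornerZ horner_prod [_ * iota _]mulrC -mulrA.
congr (_ * _); rewrite -prodMl_seq; apply: eq_bigr => r _.
by rewrite map_polyXsubC !hornerXsubC mulN1r opprB.
Qed.

(** Reciprocity: if [f] is a square in [E[X]/(g)], then so is its norm in [E],
    which equals [((-1)^n * lc)^(deg g) * N(g)]. *)
Lemma norm_odd_square g u v :
    g \is monic -> odd (size g).-1 -> coprimep u g ->
    g %| f * u ^+ 2 - v ^+ 2 ->
  exists w, (-1) ^+ n * lead_coef f * N g = w ^+ 2.
Proof.
move=> g_monic; case Dd: (size g).-1 => [//|d] odd_d.
have [A DA] : exists A : 'M[E]_d.+1, char_poly A = g.
  by rewrite -Dd; exists (companionmx g); apply: companionmxK.
have gA0 p : g %| p -> horner_mx A p = 0.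
  by move=> /dvdpP[q ->]; rewrite rmorphM -DA /= Cayley_Hamilton mulr0.
move=> /Bezout_eq1_coprimepP[[a b] /= uv1] g_dv.
have det_u : \det (horner_mx A u) != 0.
  have : \det (horner_mx A (a * u)) = 1.
    rewrite -(det1 _ d.+1) -[1%:M](rmorph1 (horner_mx A)) -uv1 rmorphD /=.
    by rewrite (gA0 (b * g)) ?dvdp_mull ?addr0.
  rewrite rmorphM det_mulmx; apply: contra_eq_neq => ->.
  by rewrite mulr0 eq_sym oner_eq0.
have det_f : \det (horner_mx A f) * \det (horner_mx A u) ^+ 2 =
             \det (horner_mx A v) ^+ 2.
  rewrite !expr2 -!detM -!rmorphM -!expr2; congr (\det _); apply/eqP.
  by rewrite -subr_eq0 -rmorphB /= gA0.
have [K [iota [rs [sz_rs Df DN]]]] := separable_splitting.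
(* The degree d.+1 of g is odd: one factor (-1) ^+ n * lead_coef f is kept,
   and the even power lead_coef f ^+ d of the rest is a square. *)
have det_fN : \det (horner_mx A f) =
    lead_coef f ^+ d * ((-1) ^+ n * lead_coef f * N g).
  apply: (fmorph_inj iota); rewrite (det_horner_mx _ Df) DA prodMl_seq sz_rs.
  rewrite -signr_odd odd_d !rmorphM !rmorphXn rmorphN1 DN exprSr expr1.
  by rewrite -!mulrA; congr (_ * _); rewrite mulrCA.
have lc_neq0 : lead_coef f != 0.
  by rewrite lead_coef_eq0; apply: separable_poly_neq0.
exists (\det (horner_mx A v) / (\det (horner_mx A u) * lead_coef f ^+ d./2)).
apply: (mulfI (expf_neq0 d lc_neq0)); rewrite -det_fN expr_div_n -det_f exprMn.
rewrite -exprM muln2 (even_halfK odd_d).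
by field; rewrite det_u expf_neq0.
Qed.

End NormOfSeparable.

(** * Points of odd degree *)

(** [h] is the minimal polynomial of the abscissa [x] of the point.  As [y] has
    degree at most 2 over [E(x)] and this degree is odd, [y] lies in [E(x)]. *)
Lemma odd_degree_minpoly (E : fieldType) (f : {poly E}) :
    has_odd_degree_point f ->
  exists h s, [/\ h \is monic, odd (size h).-1, irreducible_poly h &
    h %| f - s ^+ 2].
Proof.
move=> [L [x [y [y2 odd_xy]]]].
pose Kx := <<1; x>>%AS.
have odd_Kxy : odd (\dim <<Kx; y>>) by rewrite -adjoin_seq1 -adjoin_cons.
move: odd_Kxy; rewrite dim_Fadjoin oddM => /andP[odd_y odd_x].
have y_Kx : y \in Kx.
  rewrite -adjoin_deg_eq1; move: odd_y.
  have : minPoly Kx y %| 'X^2 - (y ^+ 2)%:P.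
    apply: minPoly_dvdp; last by rewrite /root !hornerE subrr.
    rewrite rpredB ?rpredX ?polyOverX // polyOverC y2; apply: mempx_Fadjoin.
    exact: alg_polyOver.
  move=> /dvdp_leq; rewrite size_minPoly -size_poly_gt0 size_XnsubC //.
  move=> /(_ isT).
  by case: (adjoin_degree _ _) => [|[|[|]]].
have [s Ds] := Fadjoin1_polyP y_Kx.
have /polyOver1P[h Dh] := minPolyOver 1 x.
exists h, s; have sz_h : (size h).-1 = \dim Kx.
  by rewrite -(size_map_poly (in_alg L)) -Dh size_minPoly dim_Fadjoin dimv1
             muln1.
split; first by rewrite -(map_monic (in_alg L)) -Dh monic_minPoly.
- by rewrite sz_h.
- split; first by rewrite -ltn_predRL sz_h adim_gt0.
  move=> q q_neq1 q_h; rewrite -(eqp_map (in_alg L)) -Dh.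
  have : map_poly (in_alg L) q %| minPoly 1 x by rewrite Dh dvdp_map.
  move=> /minPoly_irr; case/(_ (alg_polyOver _ _))/orP=> //.
  by rewrite -size_poly_eq1 size_map_poly (negPf q_neq1).
rewrite -(dvdp_map (in_alg L)) -Dh; apply: minPoly_dvdp.
  exact: alg_polyOver.
by rewrite /root rmorphB rmorphXn /= !hornerE -y2 Ds subrr.
Qed.

(** If the ordinate of the point vanishes, then [f = h * k] with [h] of odd
    degree.  Modulo [g = h^(2 m + 1) - k], multiplying [f] by the square of
    [h^m] gives [k * h^(2 m + 1)], which is [k^2]; so [f] is a square
    modulo [g], and [g] is coprime to [f].  A large [m] makes the odd power of
    [h] dominate, so that [g] is monic of odd degree. *)
Lemma odd_degree_coprime (E : fieldType) (f : {poly E}) :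
    separable_poly f -> has_odd_degree_point f ->
  exists g u v, [/\ g \is monic, odd (size g).-1, coprimep g f, coprimep u g &
    g %| f * u ^+ 2 - v ^+ 2].
Proof.
move=> f_sep /odd_degree_minpoly[h [s [h_monic h_odd h_irr h_dv]]].
have [hf1|] := boolP (coprimep h f).
  by exists h, 1, s; rewrite coprime1p expr1n mulr1.
rewrite irreducible_poly_coprime // negbK => /dvdpP[k Df].
have hk1 : coprimep h k by apply: separable_coprime f_sep _; rewrite Df mulrC.
pose m := size k; pose g := h ^+ m.*2.+1 - k.
have h_neq0 := monic_neq0 h_monic.
have sz_hm : (size (h ^+ m.*2.+1)).-1 = ((size h).-1 * m.*2.+1)%N.
  exact: size_exp.
have lt_k_hm : (size k < size (h ^+ m.*2.+1))%N.
  rewrite -[ltnRHS]prednK ?size_poly_gt0 ?expf_neq0 // sz_hm ltnS -/m.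
  apply: (@leq_trans m.*2.+1).
    by rewrite -addnn leqW ?leq_addr.
  by rewrite leq_pmull // odd_gt0.
have kg1 : coprimep k g.
  by rewrite /g addrC -mulN1r coprimep_addl_mul coprimep_expr // coprimep_sym.
have hg1 : coprimep h g.
  by rewrite /g exprSr -scaleN1r coprimep_addl_mul coprimepZr ?oppr_eq0
             ?oner_eq0.
exists g, (h ^+ m), k; split.
- by rewrite monicE lead_coefDl ?size_polyN // -monicE monic_exp.
- by rewrite size_polyDl ?size_polyN // sz_hm oddM h_odd /= odd_double.
- by rewrite Df coprimep_sym coprimepMl kg1.
- exact: coprimep_expl.
have -> : f * (h ^+ m) ^+ 2 - k ^+ 2 = k * g.
  by rewrite Df -exprM muln2 /g (exprS h); ring.
exact: dvdp_mull.
Qed.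

(** * Square classes in terms of polynomials *)

Section SquareClasses.

Variables (E : fieldType) (f : {poly E}).
Hypothesis f_neq0 : f != 0.

Lemma polymod_eqP p q : reflect (polymod f p = polymod f q) (f %| p - q).
Proof.
by rewrite -polymod_eq0 // rmorphB subr_eq0; apply: eqP.
Qed.

Lemma polymod_unitP p : is_unit (polymod f p) <-> coprimep p f.
Proof.
split=> [[y]|/Bezout_eq1_coprimepP[[u v] /= uv1]].
  rewrite -(polymodK y) -rmorphM -[1](rmorph1 (polymod f)) /=.
  move=> /polymod_eqP/dvdpP[c Dc]; apply/Bezout_eq1_coprimepP.
  exists (polyquot_val y, - c); rewrite /= mulNr -Dc; ring.
exists (polymod f u); rewrite -rmorphM -[RHS](rmorph1 (polymod f)) /=.
apply/polymod_eqP; apply/dvdpP; exists (- v); rewrite -uv1; ring.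
Qed.

Lemma polymod_square_classP p q :
  in_square_class (polymod f p) (polymod f q) <->
    exists2 r, coprimep r f & f %| q - p * r ^+ 2.
Proof.
split=> [[u]|[r rf1 /polymod_eqP Dq]].
  rewrite -(polymodK u) -rmorphXn -rmorphM /= => /polymod_unitP uf1.
  by move=> /polymod_eqP f_dv; exists (polyquot_val u).
exists (polymod f r); first exact/polymod_unitP.
by rewrite -rmorphXn -rmorphM.
Qed.

Lemma polymod_squareP q :
  is_unit_square (polymod f q) <->
    exists2 r, coprimep r f & f %| q - r ^+ 2.
Proof.
have := polymod_square_classP 1 q; rewrite rmorph1 => -[to_poly of_poly].
split=> [[u u_unit Dq]|[r rf1 f_dv]].
  have [|r rf1] := to_poly; first by exists u; rewrite // mul1r.
  by rewrite mul1r; exists r.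
have [|u u_unit] := of_poly; first by exists r; rewrite // mul1r.
by rewrite mul1r; exists u.
Qed.

End SquareClasses.

(** * Square-reflexivity *)

Lemma separable_square_free (E : fieldType) (f : {poly E}) :
  separable_poly f -> square_free f.
Proof.
move=> f_sep x y x_nunit Df; have [x1|x_neq1] := eqVneq (size x) 1%N.
  apply: x_nunit; have /size_poly1P[c c_neq0 ->] := introT eqP x1.
  by exists c^-1%:P; rewrite -polyCM divff.
have := separable_nosquare f_sep (ltnSn 1) x_neq1.
by rewrite Df dvdp_mulr.
Qed.

Section OddPoint.

Variables (E : fieldType) (f : {poly E}).
Hypotheses (f_sep : separable_poly f) (f_odd_point : has_odd_degree_point f).
Hypothesis f_classes : forall alpha : polyquot f, is_unit alpha ->
  exists a : E, in_square_class alpha (polymod f 'X - polymod f a%:P).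

Local Notation n := (size f).-1.
Local Notation N g := (polyquot_norm (polymod f g)).
Let f_neq0 := separable_poly_neq0 f_sep.

(** The norm of [X - a] is [f.[a]] up to the factor [(-1)^n * lc], so the norm of
    [p] decides the square class of [f.[a]], whichever [a] is chosen. *)
Lemma linear_in_class p : coprimep p f ->
  exists a r, [/\ coprimep r f, f %| ('X - a%:P) - p * r ^+ 2, f.[a] != 0 &
    f.[a] = (-1) ^+ n * lead_coef f * N p * N r ^+ 2].
Proof.
move=> pf1; have p_unit := (polymod_unitP f_neq0 p).2 pf1.
have [a] := f_classes p_unit; rewrite -rmorphB /=.
move=> /(polymod_square_classP f_neq0)[r rf1 f_dv].
exists a, r; split=> //.
  rewrite -rootE -coprimep_XsubC coprimep_sym.
  have -> : 'X - a%:P = ('X - a%:P - p * r ^+ 2) %/ f * f + p * r ^+ 2.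
    by rewrite divpK // subrK.
  by rewrite coprimep_sym coprimep_addl_mul coprimep_sym coprimepMl pf1
             coprimep_expl.
rewrite (horner_norm_XsubC f_sep) -[RHS]mulrA; congr (_ * _).
by move/(polymod_eqP f_neq0): f_dv => ->; rewrite expr2 !(normM f_sep) -expr2.
Qed.

(** A point of odd degree is turned into a rational one, by applying the class
    hypothesis to a polynomial vanishing on it (or, when its ordinate is zero,
    to the substitute for that polynomial). *)
Lemma rational_square_point : exists b t, f.[b] = t ^+ 2 /\ f.[b] != 0.
Proof.
have [g [u [v [g_monic g_odd gf1 ug1 g_dv]]]] :=
  odd_degree_coprime f_sep f_odd_point.
have [w Dw] := norm_odd_square f_sep g_monic g_odd ug1 g_dv.
have [b [r [_ _ fb_neq0 Dfb]]] := linear_in_class gf1.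
by exists b, (w * N r); rewrite {1}Dfb Dw exprMn.
Qed.

(** The factor [X - b] corrects the norm: it makes [f.[a]] agree with [N p],
    rather than with [(-1)^n * lc * N p], modulo squares. *)
Lemma norm_square_reflexive p : coprimep p f -> is_unit_square (N p) ->
  exists g, [/\ g != 0, coprimep g f,
    exists2 r, coprimep r f & f %| g - p * r ^+ 2 &
    exists2 s, coprimep s g & g %| f - s ^+ 2].
Proof.
move=> pf1 [u _ Du]; have [b [t [Dfb fb_neq0]]] := rational_square_point.
have bf1 : coprimep ('X - b%:P) f by rewrite coprimep_sym coprimep_XsubC.
have [a [r [rf1 f_dv fa_neq0 Dfa]]] : exists a r, [/\ coprimep r f,
    f %| ('X - a%:P) - p * ('X - b%:P) * r ^+ 2, f.[a] != 0 &
    f.[a] = (t * u * N r) ^+ 2].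
  have [|a [r [rf1 f_dv fa_neq0 Dfa]]] := @linear_in_class (p * ('X - b%:P)).
    by rewrite coprimepMl pf1.
  exists a, r; split; rewrite // Dfa (normM f_sep) Du -[in RHS]mulrA exprMn.
  by rewrite -Dfb (horner_norm_XsubC f_sep b); ring.
(* If a = b, then p is already the class of a square, and g = 1 will do. *)
set v := t * u * N r in Dfa; have [eq_ab|neq_ab] := eqVneq a b.
  exists 1; split; rewrite ?oner_eq0 ?coprime1p //; last first.
    by exists 1; rewrite ?coprimep1 ?dvd1p.
  exists r => //; rewrite -(Gauss_dvdpr _ (q := 'X - b%:P)) 1?coprimep_sym //.
  by move: f_dv; rewrite eq_ab; congr (f %| _); ring.
have ab_neq0 : b - a != 0 by rewrite subr_eq0 eq_sym.
have af1 : coprimep ('X - a%:P) f by rewrite coprimep_sym coprimep_XsubC.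
exists (('X - a%:P) * ('X - b%:P)); split.
- by rewrite mulf_neq0 ?polyXsubC_eq0.
- by rewrite coprimepMl af1.
- exists (('X - b%:P) * r); first by rewrite coprimepMl bf1.
  have -> : ('X - a%:P) * ('X - b%:P) - p * (('X - b%:P) * r) ^+ 2 =
    ('X - b%:P) * (('X - a%:P) - p * ('X - b%:P) * r ^+ 2) by ring.
  exact: dvdp_mull.
have [s [sa sb]] : exists s : {poly E}, s.[a] = v /\ s.[b] = t.
  exists (v%:P + ((t - v) / (b - a)) *: ('X - a%:P)).
  by split; rewrite !hornerE; [ring | field].
exists s; last first.
  rewrite Gauss_dvdp ?coprimep_XsubC2 // !dvdp_XsubCl !rootE.
  by rewrite !(hornerD, hornerN, horner_exp) sa sb Dfa Dfb !subrr eqxx.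
rewrite coprimepMr !coprimep_XsubC !rootE sa sb.
by rewrite -(sqrf_eq0 v) -(sqrf_eq0 t) -Dfa -Dfb fa_neq0.
Qed.

End OddPoint.

Theorem proposition8p6 (E : fieldType) (f : {poly E})
  (char_neq2 : 2%N \notin [pchar E])
  (f_nonconst : (1 < size f)%N)
  (f_sep : separable_poly f)
  (f_odd_point : has_odd_degree_point f)
  (f_classes : forall alpha : polyquot f, is_unit alpha ->
     exists a : E, in_square_class alpha (polymod f 'X - polymod f a%:P)) :
  square_reflexive f.
Proof.
have f_neq0 := separable_poly_neq0 f_sep.
split=> //; first exact: separable_square_free.
move=> alpha; rewrite -(polymodK alpha); set p := polyquot_val alpha.
move=> /(polymod_unitP f_neq0) pf1 norm_alpha.
suff [g [g_neq0 gf1 g_class f_square]] : exists g, [/\ g != 0, coprimep g f,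
    exists2 r, coprimep r f & f %| g - p * r ^+ 2 &
    exists2 s, coprimep s g & g %| f - s ^+ 2].
  exists g; split=> //; first exact/polymod_square_classP.
  exact/polymod_squareP.
case: norm_alpha => [|[u [u' uu'] Du]]; first exact: norm_square_reflexive.
have lc_neq0 : lead_coef f != 0 by rewrite lead_coef_eq0.
(* For even n, f.[a] has the square class of lead_coef f * N p. *)
have [odd_n|even_n] := boolP (odd (size f).-1); last first.
  have [a [r [rf1 f_dv fa_neq0 Dfa]]] := linear_in_class f_sep f_classes pf1.
  rewrite -signr_odd (negPf even_n) mul1r Du in Dfa.
  have {}Dfa : f.[a] = (lead_coef f * u * polyquot_norm (polymod f r)) ^+ 2.
    by rewrite Dfa; ring.
  set v := _ * _ in Dfa; exists ('X - a%:P); split.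
  - by rewrite polyXsubC_eq0.
  - by rewrite coprimep_sym coprimep_XsubC.
  - by exists r.
  exists v%:P; first by rewrite coprimep_XsubC rootC -sqrf_eq0 -Dfa.
  by rewrite dvdp_XsubCl rootE !hornerE Dfa subrr.
(* For odd n, scaling p by lead_coef f makes its norm a square. *)
have [||g [g_neq0 gf1 [r rf1 f_dv] [s sg1 g_dv]]] :=
  norm_square_reflexive f_sep f_odd_point f_classes
    (p := lead_coef f *: p).
- by rewrite coprimepZl.
- exists (lead_coef f ^+ uphalf (size f).-1 * u).
    exists ((lead_coef f ^+ uphalf (size f).-1)^-1 * u').
    by rewrite mulrACA uu' mulfV ?mulr1 ?expf_neq0.
  rewrite (normZ f_sep) Du mulrA -exprSr exprMn -exprM muln2.
  by rewrite odd_uphalfK.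
exists ((lead_coef f)^-1 *: g); split.
- by rewrite scaler_eq0 invr_eq0 (negPf lc_neq0).
- by rewrite coprimepZl ?invr_eq0.
- exists r => //.
  have -> : (lead_coef f)^-1 *: g - p * r ^+ 2 =
     (lead_coef f)^-1 *: (g - lead_coef f *: p * r ^+ 2).
    by rewrite scalerBr -scalerAl scalerA mulVf // scale1r.
  by rewrite dvdpZr ?invr_eq0.
exists s; first by rewrite coprimepZr ?invr_eq0.
by rewrite dvdpZl ?invr_eq0.
Qed.
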